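(* If $S$ is a finite poset of type $\widetilde{A}$, then its refined Coxeter polynomial $\phi^0_S$ is zero.
   Context: For a finite poset $S$, let $C_S$ be the $S\times S$ matrix with $(C_S)_{st}=1$ if $t\le s$ and $0$ otherwise (the Cartan matrix of the incidence algebra $KS$ over any field $K$). Refined Coxeter polynomials $\phi^0_S,\phi^1_S\in\mathbb{Z}[x]$: if $S=\varnothing$, $\phi^0_S=0$ and $\phi^1_S=1$. If $S\neq\varnothing$, choose $s\in S$, put $S'=S\setminus\{s\}$, and let $A$ be the matrix obtained from $xC_S+C_S^T$ by subtracting the $s$-th row from all other rows and then subtracting the $s$-th column from all other columns; then \[ \phi^0_S(x)=\sum_{\sigma\in\Sigma_{S'}}\mathrm{sgn}(\sigma)\prod_{i\in S'}A_{i\sigma(i)},\qquad \phi^1_S(x)=\sum_{\sigma\in\Sigma_S,\ \sigma(s)\ne s}\mathrm{sgn}(\sigma)\prod_{i\in S}A_{i\sigma(i)}, \] where $\Sigma_{S'},\Sigma_S$ are the permutation groups of $S'$ and $S$; these do not depend on the choice of $s$. The Hasse quiver of $S$ has the elements of $S$ as vertices and an arrow $s\to s'$ whenever $s'$ covers $s$. A poset $S$ is of type $\widetilde{A}$ if its incidence algebra $KS$ is a path algebra of an orientation of a Euclidean diagram of type $\widetilde{A}$. Explicitly: the Hasse quiver of $S$ is an orientation of a cycle such that, going around the cycle, the clockwise arrows form $k$ maximal runs and the anti-clockwise arrows form $k$ maximal runs with $k\ge 2$. *)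

(* Defs.v *)
From mathcomp Require Import all_boot all_order all_algebra.

Set Implicit Arguments.
Unset Strict Implicit.
Unset Printing Implicit Defensive.

Import Order.TTheory GRing.Theory.
Local Open Scope ring_scope.

Definition subtract_row (R : nzRingType) (n : nat) (s : 'I_n) (A : 'M[R]_n) :
    'M[R]_n :=
  \matrix_(i, j) if i == s then A i j else A i j - A s j.

Definition subtract_col (R : nzRingType) (n : nat) (s : 'I_n) (A : 'M[R]_n) :
    'M[R]_n :=
  \matrix_(i, j) if j == s then A i j else A i j - A i s.

(* S x S matrices are indexed by 'I_#|S| through the enumeration enum_val of S. *)
Definition cartan_mx (d : Order.disp_t) (S : finPOrderType d) :
    'M[{poly int}]_#|S| :=
  \matrix_(s, t) ((enum_val t <= enum_val s :> S)%O)%:R.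

Definition coxeter_mx (d : Order.disp_t) (S : finPOrderType d) :
    'M[{poly int}]_#|S| :=
  'X *: cartan_mx S + (cartan_mx S)^T.

Definition refined_coxeter0_at (d : Order.disp_t) (S : finPOrderType d)
    (s : S) : {poly int} :=
  let i := enum_rank s in
  \det (row' i (col' i (subtract_col i (subtract_row i (coxeter_mx S))))).

(* The element picked is irrelevant, by refined_coxeter0_at_indep below. *)
Definition refined_coxeter0 (d : Order.disp_t) (S : finPOrderType d) :
    {poly int} :=
  if [pick s : S] is Some s then refined_coxeter0_at s else 0.

Definition hasse (d : Order.disp_t) (S : finPOrderType d) : rel S :=
  fun s s' => (s < s')%O && ~~ [exists u, (s < u < s')%O].

(* The vertices in cyclic order, with next c x following x clockwise.  A loop
   or a double edge cannot occur in a Hasse quiver, hence 2 < size c. *)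
Definition hasse_cycle (d : Order.disp_t) (S : finPOrderType d) (c : seq S) :
    Prop :=
  [/\ uniq c, (2 < size c)%N, forall x : S, x \in c &
      forall x y : S, hasse x y || hasse y x = (y == next c x) || (x == next c y)].

(* The arrow between x and next c x is named by x. *)
Definition clockwise (d : Order.disp_t) (S : finPOrderType d) (c : seq S) :
    pred S :=
  fun x => hasse x (next c x).

Definition anticlockwise (d : Order.disp_t) (S : finPOrderType d) (c : seq S) :
    pred S :=
  fun x => hasse (next c x) x.

(* Each maximal run is counted through its first arrow.  This would miss a run
   that fills the whole cycle, but a Hasse quiver has no oriented cycle. *)
Definition num_runs (T : finType) (c : seq T) (a : pred T) : nat :=
  #|[set x | a x && ~~ a (prev c x)]|.

Definition type_A_tilde (d : Order.disp_t) (S : finPOrderType d) : Prop :=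
  exists (c : seq S) (k : nat),
    [/\ hasse_cycle c, (2 <= k)%N,
        num_runs c (clockwise c) = k & num_runs c (anticlockwise c) = k].

Lemma det_subtract (R : comNzRingType) (n : nat) (s : 'I_n) (A : 'M[R]_n) :
  \det (row' s (col' s (subtract_col s (subtract_row s A)))) =
  \det (A + const_mx 1) - \det A.
Proof.
pose E : 'M[R]_n := \matrix_(i, j) ((i == j)%:R - ((i != s) && (j == s))%:R).
have detE : \det E = 1.
  rewrite (expand_det_row _ s) (bigD1 s) //= big1 ?addr0; last first.
    by move=> j js; rewrite !mxE eqxx eq_sym (negPf js) subr0 mul0r.
  rewrite !mxE eqxx subr0 mul1r /cofactor addnn -signr_odd odd_double mul1r.
  rewrite -[RHS](det1 R n.-1); congr (\det _); apply/matrixP => i j.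
  by rewrite !mxE (inj_eq lift_inj) [lift s j == s]eq_sym (negPf (neq_lift s j))
    andbF subr0.
have mulE (M : 'M[R]_n) : E *m M = subtract_row s M.
  apply/matrixP => i j; rewrite !mxE (eq_bigr (fun k =>
    (i == k)%:R * M k j - ((i != s) && (k == s))%:R * M k j)); last first.
    by move=> k _; rewrite !mxE mulrBl.
  rewrite sumrB (bigD1 i) //= big1 ?addr0; last first.
    by move=> k ki; rewrite eq_sym (negPf ki) mul0r.
  rewrite eqxx mul1r (bigD1 s) //= big1 ?addr0; last first.
    by move=> k ks; rewrite (negPf ks) andbF mul0r.
  by rewrite eqxx andbT; case: (i == s); rewrite /= ?mul0r ?subr0 ?mul1r.
have mulEt (M : 'M[R]_n) : M *m E^T = subtract_col s M.
  apply: trmx_inj; rewrite trmx_mul trmxK mulE.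
  by apply/matrixP => i j; rewrite !mxE.
have detB (M : 'M[R]_n) : \det (subtract_col s (subtract_row s M)) = \det M.
  by rewrite -mulE -mulEt !det_mulmx det_tr detE mul1r mulr1.
rewrite -(detB A) -(detB (A + _)).
set B := subtract_col s (subtract_row s A).
have -> : subtract_col s (subtract_row s (A + const_mx 1)) =
    B + delta_mx s s.
  rewrite -!mulE -!mulEt mulmxDr mulmxDl; rewrite mulEt mulE -/B.
  congr (_ + _); rewrite mulEt mulE; apply/matrixP => i j; rewrite !mxE.
  by case: (i == s); case: (j == s); rewrite /= ?subrr ?subr0.
have cofE j : cofactor (B + delta_mx s s) s j = cofactor B s j.
  congr (_ * \det _); apply/matrixP => i k; rewrite !mxE.
  by rewrite [lift s i == s]eq_sym (negPf (neq_lift s i)) addr0.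
rewrite !(expand_det_row _ s) -sumrB (bigD1 s) //= big1 ?addr0; last first.
  by move=> j js; rewrite cofE !mxE (negPf js) andbF addr0 subrr.
rewrite cofE [(_ + delta_mx _ _) _ _]mxE [delta_mx _ _ _ _]mxE !eqxx.
rewrite mulrDl mul1r addrAC subrr add0r.
by rewrite /cofactor addnn -signr_odd odd_double mul1r.
Qed.

Lemma refined_coxeter0_at_indep (d : Order.disp_t) (S : finPOrderType d)
    (s t : S) :
  refined_coxeter0_at s = refined_coxeter0_at t.
Proof. by rewrite /refined_coxeter0_at !det_subtract. Qed.

(* Main.v *)
Require Import Defs.
From mathcomp Require Import all_boot all_order all_algebra.

(** The refined polynomial is the determinant of the bilinear form of
    M = x C + C^T restricted to the vectors of coordinate sum zero, so it
    vanishes as soon as some nonzero v of coordinate sum zero has M v constant: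
    such a v lies in the kernel of that restricted form
    ([det_reduced_eq0]).

    For a poset of type A-tilde take v t = 1 - (number of elements that t
    covers), that is, 1 at the minimal elements, -1 at the maximal ones and 0
    elsewhere; then M v is the constant vector x - 1.  Indeed (C v) s is the
    number of vertices minus the number of edges of the part of the Hasse
    diagram lying below s.  That part is connected, and it is not the whole
    cycle because there are at least two maximal elements, so it is a segment
    of the cycle and its Euler characteristic is 1 ([sum_weight_below]).
    Since every vertex of a cycle has degree 2, passing to the opposite order
    changes v to -v ([weight_rev]); the same count above s therefore gives
    (C^T v) s = -1.  The coordinate sum of v is the Euler characteristic of
    the whole cycle, which is 0 ([sum_weight]). *)

Set Implicit Arguments.
Unset Strict Implicit.
Unset Printing Implicit Defensive.

Import Order.TTheory GRing.Theory.
Local Open Scope ring_scope.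

(** * Oriented cycles *)

(** The rotation [f] fixes a sense of traversal, with which the arrows [h] may
    agree or not; reversing all the arrows is thus a symmetry of the notion. *)
Record oriented_cycle (T : finType) (f : T -> T) (h : rel T) : Prop :=
  OrientedCycle {
    oc_adj : forall x y, h x y || h y x = (y == f x) || (x == f y);
    oc_asym : forall x y, h x y -> ~~ h y x;
    oc_inj : injective f;
    oc_simple : forall x, f (f x) != x;
    oc_connect : forall x y, fconnect f x y
  }.

Definition rev_rel (T : Type) (h : rel T) : rel T := fun x y => h y x.

Lemma oriented_cycle_rev (T : finType) (f : T -> T) (h : rel T) :
  oriented_cycle f h -> oriented_cycle f (rev_rel h).
Proof.
case=> adj asym inj simple conn; split=> // x y; last exact: asym.
by rewrite orbC adj.
Qed.

Definition sink (T : Type) (h : rel T) (x : T) : Prop := forall y, ~~ h x y.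

(** On a cycle a directed path cannot turn around.  So a path from [x] to [s]
    whose first arrow cannot go along [f] runs against [f] all the way. *)
Lemma connect_against (T : finType) (f : T -> T) (h : rel T) (s x : T) :
    oriented_cycle f h -> connect h x s ->
    (h x (f x) -> ~~ connect h (f x) s) ->
  exists2 m, x = iter m f s & forall i, (i <= m)%N -> connect h (iter i f s) s.
Proof.
move=> oc /connectP[p]; elim: p x => [|y p IHp] x /= => [_ -> _|].
  by exists 0%N => // i; rewrite leqn0 => /eqP->; apply: connect0.
case/andP=> hxy hp def_s xNfx.
have ys : connect h y s by apply/connectP; exists p.
have xy : x = f y.
  have := oc_adj oc x y; rewrite hxy /= => /esym/orP[] /eqP // yfx.
  by move: (xNfx); rewrite -yfx ys => /(_ hxy).
have [|m def_y conn_m] := IHp y hp def_s.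
  by rewrite -xy => hyx; move: (oc_asym oc hxy); rewrite hyx.
exists m.+1 => [|i]; first by rewrite iterS -def_y.
rewrite leq_eqVlt ltnS => /orP[/eqP->|]; last exact: conn_m.
by rewrite iterS -def_y -xy; apply: connect_trans (connect1 hxy) ys.
Qed.

(** An exit is a vertex below [s] whose [f]-successor is not below [s].  Both
    exits are reached from [s] by following [f] inside the set below [s];
    the one reached first would have its successor in that set. *)
Lemma exit_unique (T : finType) (f : T -> T) (h : rel T) (s x y : T) :
    oriented_cycle f h ->
    connect h x s -> ~~ connect h (f x) s ->
    connect h y s -> ~~ connect h (f y) s ->
  x = y.
Proof.
move=> oc xs fxs ys fys.
have [m def_x conn_m] := connect_against oc xs (fun _ => fxs).
have [n def_y conn_n] := connect_against oc ys (fun _ => fys).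
case: (ltngtP m n) => [lt_mn|lt_nm|eq_mn]; last by rewrite def_x def_y eq_mn.
  by move: fxs; rewrite def_x -iterS conn_n.
by move: fys; rewrite def_y -iterS conn_m.
Qed.

(** Were there no exit, the set below [s] would be the whole cycle, and [s] the
    only sink. *)
Lemma exit_exists (T : finType) (f : T -> T) (h : rel T) (s a b : T) :
    oriented_cycle f h -> a != b -> sink h a -> sink h b ->
  exists2 x, connect h x s & ~~ connect h (f x) s.
Proof.
move=> oc ab sink_a sink_b.
have [/existsP[x /andP[xs fxs]]|no_exit] :=
  boolP [exists x, connect h x s && ~~ connect h (f x) s].
  by exists x.
have all_below x : connect h x s.
  have /iter_findex <- := oc_connect oc s x.
  elim: (findex _ _ _) => [|n IHn]; first exact: connect0.
  apply: contraNT no_exit => fns; apply/existsP.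
  by exists (iter n f s); rewrite IHn.
have sinkE x : sink h x -> x = s.
  move=> sink_x; have /connectP[[|y p] //=] := all_below x.
  by rewrite (negPf (sink_x y)).
by rewrite (sinkE a) // (sinkE b) // eqxx in ab.
Qed.

Definition indegree (T : finType) (h : rel T) (t : T) : nat :=
  (\sum_u h u t)%N.

Lemma indegree_rev (T : finType) (f : T -> T) (h : rel T) (t : T) :
  oriented_cycle f h -> (indegree h t + indegree (rev_rel h) t = 2)%N.
Proof.
move=> oc; rewrite -big_split /=.
have eq_tf u : (h u t + rev_rel h u t = (u == f t) + (u == finv f t))%N.
  have -> : (u == finv f t) = (t == f u).
    by apply/eqP/eqP => ->; rewrite ?f_finv ?finv_f //; apply: oc_inj oc.
  have := oc_adj oc u t; rewrite /rev_rel.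
  have := @oc_asym _ _ _ oc u t; case: (h u t) => [/(_ isT)/negPf->|_] /=;
    [|case: (h t u)];
    case: (t =P f u) => [->|_]; case: (_ =P _) => [e|_] //;
    by have := oc_simple oc u; rewrite -e eqxx.
under eq_bigr => u _ do rewrite eq_tf.
rewrite big_split /= (bigD1 (f t)) //= eqxx big1 => [|u /negPf->//].
by rewrite (bigD1 (finv f t)) //= eqxx big1 => // u /negPf->.
Qed.

(** The arrows ending in a set closed under predecessors are those with both
    ends in it, and an arrow of the cycle is a pair of the form x, f x. *)
Lemma sum_indegree (T : finType) (f : T -> T) (h : rel T) (D : pred T) :
    oriented_cycle f h -> (forall x y, h x y -> D y -> D x) ->
  (\sum_(t | D t) indegree h t = \sum_x (D x && D (f x)))%N.
Proof.
move=> oc D_closed.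
(* An arrow goes along [f] or against it, and not both ways at once because
   the cycle has more than two vertices. *)
have hE u t :
    (h u t = (t == f u) * h u (f u) + (u == f t) * h (f t) t :> nat)%N.
  have := oc_adj oc u t.
  case: (t =P f u) => [def_t|_]; case: (u =P f t) => [def_u|_] /=.
  - by have := oc_simple oc t; rewrite -def_u -def_t eqxx.
  - by rewrite -def_t mul1n addn0.
  - by rewrite -def_u mul1n.
  by move/norP=> [/negPf->].
have hf x : (h x (f x) + h (f x) x = 1)%N.
  have := oc_adj oc x (f x); rewrite eqxx /=.
  have := @oc_asym _ _ _ oc x (f x).
  by case: (h x (f x)) => /= [/(_ isT)/negPf->|_ ->].
transitivity (\sum_x (D (f x) * h x (f x) + D x * h (f x) x))%N; last first.
  apply: eq_bigr => x _; have := hf x.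
  case hxf: (h x (f x)); case hfx: (h (f x) x) => //= _.
    rewrite muln1 muln0 addn0.
    by case: (boolP (D (f x))) => [/(D_closed _ _ hxf)->|_]; rewrite ?andbF.
  rewrite muln1 muln0 add0n.
  by case: (boolP (D x)) => [/(D_closed _ _ hfx)->|_].
rewrite big_split /=.
under eq_bigr => t _ do
  (rewrite /indegree; under eq_bigr => u _ do rewrite hE; rewrite big_split /=).
rewrite big_split /=; congr (_ + _)%N.
  rewrite exchange_big /=; apply: eq_bigr => u _.
  rewrite -big_distrl /= big_mkcond (bigD1 (f u)) //= eqxx big1 => [|t].
    by rewrite addn0; case: (D _).
  by move/negPf->; case: ifP.
rewrite big_mkcond; apply: eq_bigr => t _.
case: (D t) => //; rewrite (bigD1 (f t)) //= eqxx big1 ?addn0 // => u.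
by move/negPf->.
Qed.

Definition weight (R : pzRingType) (T : finType) (h : rel T) (t : T) : R :=
  1 - (indegree h t)%:R.

Lemma weight_rev (R : pzRingType) (T : finType) (f : T -> T) (h : rel T)
    (t : T) :
  oriented_cycle f h -> weight R (rev_rel h) t = - weight R h t.
Proof.
move=> oc; apply/eqP; rewrite -subr_eq0 opprK /weight addrACA -opprD -natrD.
by rewrite addnC (indegree_rev t oc) subrr.
Qed.

(** The Euler characteristic of a set closed under predecessors: the vertices
    that remain once the inner arrow joining x and f x, in either direction, is
    matched with x. *)
Lemma sum_weight_closed (R : pzRingType) (T : finType) (f : T -> T) (h : rel T)
    (D : pred T) :
    oriented_cycle f h -> (forall x y, h x y -> D y -> D x) ->
  \sum_(t | D t) weight R h t = (\sum_x (D x && ~~ D (f x)))%N%:R.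
Proof.
move=> oc D_closed; rewrite sumrB -natr_sum (sum_indegree oc D_closed).
have -> : \sum_(t | D t) 1 = (\sum_x D x)%N%:R :> R.
  by rewrite natr_sum big_mkcond; apply: eq_bigr => x _; case: (D x).
apply/eqP; rewrite subr_eq -natrD -big_split /=; apply/eqP; congr _%:R.
by apply: eq_bigr => x _; case: (D x); case: (D (f x)).
Qed.

Lemma sum_weight (R : pzRingType) (T : finType) (f : T -> T) (h : rel T) :
  oriented_cycle f h -> \sum_t weight R h t = 0.
Proof.
by move=> oc; rewrite (sum_weight_closed R (D := predT) oc) //= big1_eq.
Qed.

(** The set below [s] is an arc of the cycle, as it is left only once along
    [f]. *)
Lemma sum_weight_below (R : pzRingType) (T : finType) (f : T -> T) (h : rel T)
    (s a b : T) :
    oriented_cycle f h -> a != b -> sink h a -> sink h b ->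
  \sum_(t | connect h t s) weight R h t = 1.
Proof.
move=> oc ab sink_a sink_b.
rewrite (sum_weight_closed R (D := fun t => connect h t s) oc); last first.
  by move=> x y /connect1; apply: connect_trans.
have [x xs fxs] := exit_exists s oc ab sink_a sink_b.
rewrite (bigD1 x) //= xs fxs big1 // => y yx; apply/eqP; rewrite eqb0.
apply: contra yx => /andP[ys fys]; apply/eqP.
exact: exit_unique oc ys fys xs fxs.
Qed.

(** * Hasse quivers *)

Lemma connect_hasse (d : Order.disp_t) (S : finPOrderType d) (x y : S) :
  connect (@hasse d S) x y = (x <= y)%O.
Proof.
apply/idP/idP => [/connectP[p]|].
  elim: p x => [|z p IHp] x /= => [_ -> //|].
  case/andP=> /andP[xz _] hp def_y.
  exact: le_trans (ltW xz) (IHp z hp def_y).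
have [n] := ubnP #|[set z | x < z < y]%O|.
elim: n => // n IHn in x y *; rewrite ltnS => le_n.
rewrite le_eqVlt => /orP[/eqP->|xy]; first exact: connect0.
have [hxy|] := boolP (hasse x y); first exact: connect1.
rewrite /hasse xy negbK => /existsP[u /andP[xu uy]].
apply: (@connect_trans _ _ u); apply: IHn; rewrite ?(ltW xu) ?(ltW uy) //;
  apply: leq_trans le_n; apply: proper_card; apply/properP; split;
  try (by exists u; rewrite !inE ?xu ?uy ?ltxx ?andbF);
  apply/subsetP => z; rewrite !inE => /andP[lt1 lt2].
- by rewrite lt1 (lt_trans lt2 uy).
by rewrite lt2 (lt_trans xu lt1).
Qed.

Lemma hasse_asym (d : Order.disp_t) (S : finPOrderType d) (x y : S) :
  hasse x y -> ~~ hasse y x.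
Proof. by case/andP=> xy _; rewrite /hasse (lt_gtF xy). Qed.

Lemma hasse_oriented_cycle (d : Order.disp_t) (S : finPOrderType d)
    (c : seq S) :
  hasse_cycle c -> oriented_cycle (next c) (@hasse d S).
Proof.
case=> c_uniq c_size c_all c_adj.
have cyc := cycle_next c_uniq.
split=> //; first exact: hasse_asym.
- by move=> x y eq_next; rewrite -(prev_next c_uniq x) eq_next prev_next.
- move=> x; apply/eqP => ffx.
  have x_cycle : fcycle (next c) [:: x; next c x] by rewrite /= ffx !eqxx.
  have := order_le_cycle x_cycle (mem_head _ _).
  by rewrite (order_cycle cyc c_uniq (c_all x)) leqNgt c_size.
by move=> x y; rewrite (fconnect_cycle cyc (c_all x)).
Qed.

Lemma num_runs_ge2 (T : finType) (c : seq T) (a : pred T) (P : T -> Prop) :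
    (forall x, a x && ~~ a (prev c x) -> P x) -> (2 <= num_runs c a)%N ->
  exists x y, [/\ x != y, P x & P y].
Proof.
move=> aP /card_gt1P[x [y [+ + xy]]]; rewrite !inE => /aP Px /aP Py.
by exists x, y.
Qed.

(** The first arrow of an anti-clockwise run and the clockwise arrow before it
    point at each other: both end in [x]. *)
Lemma anticlockwise_run_sink (d : Order.disp_t) (S : finPOrderType d)
    (c : seq S) (x : S) :
    hasse_cycle c -> anticlockwise c x && ~~ anticlockwise c (prev c x) ->
  sink (@hasse d S) x.
Proof.
case=> c_uniq _ _ c_adj; rewrite /anticlockwise next_prev //.
move=> /andP[hnx hxp] y.
apply/negP => hxy; have := c_adj x y; rewrite hxy => /esym/orP[] /eqP def.
  by move: (hasse_asym hnx); rewrite -def hxy.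
by move: hxp hxy; rewrite def prev_next // => /negPf->.
Qed.

Lemma clockwise_run_source (d : Order.disp_t) (S : finPOrderType d)
    (c : seq S) (x : S) :
    hasse_cycle c -> clockwise c x && ~~ clockwise c (prev c x) ->
  sink (rev_rel (@hasse d S)) x.
Proof.
case=> c_uniq _ _ c_adj; rewrite /clockwise next_prev // => /andP[hxn hpx] y.
apply/negP; rewrite /rev_rel => hyx.
have := c_adj x y; rewrite hyx orbT => /esym/orP[] /eqP def.
  by move: (hasse_asym hxn); rewrite -def hyx.
by move: hpx hyx; rewrite def prev_next // => /negPf->.
Qed.

(** * The kernel vector *)

Lemma det_eq0 (R : idomainType) (n : nat) (A : 'M[R]_n) (v : 'cV[R]_n) :
  v != 0 -> A *m v = 0 -> \det A = 0.
Proof.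
move=> v0 Av; apply/eqP; have: \det A *: v = 0.
  by rewrite -mul_scalar_mx -mul_adj_mx -mulmxA Av mulmx0.
by move/eqP; rewrite scalemx_eq0 (negPf v0) orbF.
Qed.

(** The reduced matrix is the Gram matrix of the form [A] on the vectors
    e_i - e_s, where a vector of coordinate sum zero has the coordinates
    [v i 0] for i different from s.  If [v] vanished there it would vanish
    altogether, and [c] with it. *)
Lemma det_reduced_eq0 (R : idomainType) (n : nat) (s : 'I_n) (A : 'M[R]_n)
    (v : 'cV[R]_n) (c : R) :
    A *m v = const_mx c -> c != 0 -> \sum_i v i 0 = 0 ->
  \det (row' s (col' s (subtract_col s (subtract_row s A)))) = 0.
Proof.
move=> Av c0 v_sum0; apply: (@det_eq0 _ _ _ (row' s v)).
  apply: contra c0 => /eqP v'0.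
  have v0 i : i != s -> v i 0 = 0.
    rewrite eq_sym => /unlift_some[j -> _].
    by have /matrixP/(_ j 0) := v'0; rewrite !mxE.
  have vs : v s 0 = 0.
    by move: v_sum0; rewrite (bigD1 s) //= big1 ?addr0 // => i; apply: v0.
  have: (A *m v) s 0 = c by rewrite Av mxE.
  rewrite mxE big1 => [-> //|i _].
  by have [->|/v0->] := eqVneq i s; rewrite ?vs mulr0.
have AvE i : \sum_j A i j * v j 0 = c.
  by have /matrixP/(_ i 0) := Av; rewrite !mxE.
apply/matrixP => i z; rewrite ord1 !mxE {z}.
(* Summing over all j costs nothing: the entry at j = s is zero. *)
pose g j := (A (lift s i) j - A s j - (A (lift s i) s - A s s)) * v j 0.
have : \sum_j g j = 0.
  rewrite /g; under eq_bigr => j _ do rewrite !mulrBl.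
  by rewrite !sumrB !AvE -!mulr_sumr v_sum0 !mulr0 !subrr.
rewrite (bigD1_ord s) //= {1}/g subrr mul0r add0r; apply: etrans.
apply: eq_bigr => j _; rewrite /g !mxE.
by rewrite ![lift s _ == s]eq_sym !(negPf (neq_lift _ _)).
Qed.

Theorem theorem4p8 (d : Order.disp_t) (S : finPOrderType d)
    (hS : type_A_tilde S) : refined_coxeter0 S = 0.
Proof.
case: hS => c [k [hc k2 cw acw]].
rewrite /refined_coxeter0; case: pickP => // s _; rewrite /refined_coxeter0_at.
have oc := hasse_oriented_cycle hc.
have oc' := oriented_cycle_rev oc.
have [a [b [ab sink_a sink_b]]] :
    exists x y, [/\ x != y, sink (@hasse d S) x & sink (@hasse d S) y].
  apply: (num_runs_ge2 (c := c) (a := anticlockwise c)); last by rewrite acw.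
  by move=> x; apply: anticlockwise_run_sink.
have [a' [b' [ab' source_a source_b]]] :
    exists x y, [/\ x != y, sink (rev_rel (@hasse d S)) x &
      sink (rev_rel (@hasse d S)) y].
  apply: (num_runs_ge2 (c := c) (a := clockwise c)); last by rewrite cw.
  by move=> x; apply: clockwise_run_source.
pose p (t : S) : {poly int} := weight _ (@hasse d S) t.
have sum_below (t : S) : \sum_(u | (u <= t)%O) p u = 1.
  rewrite -(sum_weight_below _ t oc ab sink_a sink_b).
  by apply: eq_bigl => u; rewrite connect_hasse.
have sum_above (t : S) : \sum_(u | (t <= u)%O) p u = - 1.
  rewrite -(sum_weight_below _ t oc' ab' source_a source_b) -sumrN.
  apply: eq_big => [u|u _]; first by rewrite connect_rev /= connect_hasse.
  by rewrite (weight_rev _ u oc) opprK.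
apply: (@det_reduced_eq0 _ _ _ _ (\col_i p (enum_val i)) ('X - 1)).
- apply/matrixP => i j; rewrite !mxE.
  pose x := enum_val i.
  pose g u := ('X * (u <= x)%O%:R + (x <= u)%O%:R) * p u.
  transitivity (\sum_(u in S) g u).
    by rewrite [RHS]big_enum_val; apply: eq_bigr => l _; rewrite !mxE.
  under eq_bigr => u _ do rewrite /g mulrDl -mulrA.
  rewrite big_split -mulr_sumr /=.
  rewrite -[in RHS](sum_above x) [in RHS]big_mkcond.
  have -> : \sum_(u in S) (u <= x)%O%:R * p u = 1.
    rewrite -[RHS](sum_below x) [in RHS]big_mkcond.
    by apply: eq_bigr => u _; rewrite mulr_natl mulrb.
  rewrite mulr1; congr (_ + _).
  by apply: eq_bigr => u _; rewrite mulr_natl mulrb.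
- by rewrite -[1]/(1%:P) polyXsubC_eq0.
under eq_bigr => i _ do rewrite mxE.
by rewrite -(big_enum_val (A := S) p) (sum_weight _ oc).
Qed.
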